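(* Let $n = p^2$, where $p \geq 5$ is a prime number. Then the Wiener index of the line graph $L(\Gamma(\mathbb{Z}_{p^2}))$ is $W(L(\Gamma(\mathbb{Z}_{p^2}))) = \dfrac{1}{4}(p-1)(p-2)^2(p-3)$.
   Context: For a positive integer $n$, $\mathbb{Z}_n$ is the ring of residue classes modulo $n$. The zero-divisor graph $\Gamma(\mathbb{Z}_n)$ is the simple undirected graph whose vertices are the nonzero zero-divisors of $\mathbb{Z}_n$ (nonzero $x \in \mathbb{Z}_n$ such that $xy = 0$ for some nonzero $y \in \mathbb{Z}_n$), with distinct vertices $x,y$ adjacent if and only if $xy=0$. The line graph $L(\Gamma(\mathbb{Z}_n))$ is the graph whose vertices are the edges of $\Gamma(\mathbb{Z}_n)$, two distinct vertices being adjacent if the corresponding edges share a common vertex in $\Gamma(\mathbb{Z}_n)$. The Wiener index of a finite connected graph $G$ with vertex set $V$ is $W(G) = \frac{1}{2}\sum_{x,y \in V} d(x,y)$, the sum being over all ordered pairs $(x,y)$, where $d(x,y)$ is the length of a shortest path between $x$ and $y$. *)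

(* Defs.v *)
From HB Require Import structures.
From mathcomp Require Import all_boot all_order all_algebra.

Set Implicit Arguments.
Unset Strict Implicit.
Unset Printing Implicit Defensive.

Import GRing.Theory.
Local Open Scope ring_scope.

Record sgraph := SGraph {
  vertex :> finType;
  adj : rel vertex;
  adj_sym : symmetric adj;
  adj_irr : irreflexive adj
}.

Section GraphNotions.

Variable G : sgraph.

Definition edges : {set {set G}} :=
  [set e | [exists x : G, [exists y : G, adj x y && (e == [set x; y])]]].

Definition edge := {e : {set G} | e \in edges}.

(* A path of length k from x to y is given, as in path.v, by x and the k
   vertices following it. *)
Definition has_path (k : nat) (x y : G) : bool :=
  [exists s : k.-tuple G,
    [&& path (@adj G) x s, uniq (x :: s) & last x s == y]].

(* A path has fewer than #|G| edges, so this is the least length of a path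
   from x to y if there is one; otherwise it is the dummy value #|G|. *)
Definition dist (x y : G) : nat :=
  find (fun k => has_path k x y) (iota 0 #|G|).

Definition wiener_index : rat :=
  1 / 2%:R * \sum_(x : G) \sum_(y : G) (dist x y)%:R.

Definition line_adj (e f : edge) : bool :=
  (e != f) && (val e :&: val f != set0).

Lemma line_adj_sym : symmetric line_adj.
Proof. by move=> e f; rewrite /line_adj eq_sym setIC. Qed.

Lemma line_adj_irr : irreflexive line_adj.
Proof. by move=> e; rewrite /line_adj eqxx. Qed.

Definition line_graph : sgraph := SGraph line_adj_sym line_adj_irr.

Lemma has_path_dist (x y : G) :
  connect (@adj G) x y -> has_path (dist x y) x y.
Proof.
case/connectP=> s /shortenP[t xt ut _ ->].
have tG : (size t < #|G|)%N.
  by rewrite -[(size t).+1]/(size (x :: t)) -(card_uniqP ut) max_card.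
have h : has (fun k => has_path k x (last x t)) (iota 0 #|G|).
  apply/hasP; exists (size t); first by rewrite mem_iota.
  by apply/existsP; exists (in_tuple t); apply/and3P.
have := nth_find 0%N h; rewrite nth_iota ?add0n //.
by move: h; rewrite has_find size_iota.
Qed.

Lemma dist_min (x y : G) (k : nat) : has_path k x y -> (dist x y <= k)%N.
Proof.
move=> xy; have kG : (k < #|G|)%N.
  have /existsP[s /and3P[_ us _]] := xy.
  by rewrite -(size_tuple s) -[(size s).+1]/(size (x :: s)) -(card_uniqP us)
             max_card.
rewrite leqNgt; apply/negP => /(before_find 0%N).
by rewrite nth_iota // add0n xy.
Qed.

End GraphNotions.

Section ZeroDivisorGraph.

Variable R : finComNzRingType.

Definition nonzero_zero_divisor (x : R) : bool :=
  (x != 0) && [exists y : R, (y != 0) && (x * y == 0)].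

Definition zd_vertex := {x : R | nonzero_zero_divisor x}.

Definition zd_adj (x y : zd_vertex) : bool :=
  (x != y) && (val x * val y == 0).

Lemma zd_adj_sym : symmetric zd_adj.
Proof. by move=> x y; rewrite /zd_adj eq_sym mulrC. Qed.

Lemma zd_adj_irr : irreflexive zd_adj.
Proof. by move=> x; rewrite /zd_adj eqxx. Qed.

Definition zero_divisor_graph : sgraph := SGraph zd_adj_sym zd_adj_irr.

End ZeroDivisorGraph.

(* Main.v *)
Require Import Defs.
From mathcomp Require Import all_boot all_order all_algebra.
From mathcomp Require Import ring.

(** The nonzero zero-divisors of Z_(p^2) are the p - 1 nonzero multiples of p,
    and any two of them have product 0, so the zero-divisor graph is complete
    on m = p - 1 vertices. In the line graph of a complete graph
    d(e, f) = 2 - #|e :&: f|. Summing over all pairs of edges and counting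
    the triples (x, e, f) with x in both e and f by x, we get
    2 'C(m, 2)^2 - m (m - 1)^2. *)

Import GRing.Theory.
Local Open Scope ring_scope.

Section Distance.

Variable G : sgraph.
Implicit Types x y z : G.

Lemma has_path0 x y : has_path 0 x y = (x == y).
Proof.
apply/existsP/idP => [[s]|xy]; last by exists [tuple].
by rewrite tuple0 /=.
Qed.

Lemma has_path1 x y : has_path 1 x y = adj x y.
Proof.
apply/existsP/idP => [[s]|xy].
  case: s => -[|z [|? ?]] //= _.
  by rewrite andbT => /and3P[xz _ /eqP <-].
exists [tuple y]; rewrite /= xy eqxx inE !andbT.
by apply: contraTneq xy => ->; rewrite adj_irr.
Qed.

(** [has_path] forbids repeated vertices: [x != y] must be assumed, while irreflexivity of adjacency
    keeps [z] apart from both ends. *)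
Lemma has_path2 x y z : x != y -> adj x z -> adj z y -> has_path 2 x y.
Proof.
move=> xy xz zy; apply/existsP; exists [tuple z; y].
rewrite /= xz zy eqxx !inE negb_or xy !andbT /=.
by apply/andP; split; [apply: contraTneq xz | apply: contraTneq zy] => ->;
  rewrite adj_irr.
Qed.

(** The path of length [k] makes [x] and [y] connected, so [dist x y] is not its dummy value but the
    length of an actual path, and minimality of [k] applies to it. *)
Lemma dist_eq k x y :
  has_path k x y -> (forall j, (j < k)%N -> ~~ has_path j x y) -> dist x y = k.
Proof.
move=> xyk min_k; apply/eqP; rewrite eqn_leq dist_min //= leqNgt.
apply/negP => /min_k/negP; apply; apply: has_path_dist.
have /existsP[s /and3P[xs _ /eqP <-]] := xyk.
by apply/connectP; exists s.
Qed.

End Distance.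

Section CompleteGraph.

Variable G : sgraph.
Hypothesis complete : forall x y : G, adj x y = (x != y).

Lemma complete_edgesE : edges G = [set e : {set G} | #|e| == 2].
Proof.
apply/setP => e; rewrite !inE; apply/existsP/cards2P => [[x /existsP[y]]|].
  by rewrite complete => /andP[xy /eqP ->]; exists x, y.
by case=> x [y [xy ->]]; exists x; apply/existsP; exists y; rewrite complete xy /=.
Qed.

Lemma card_complete_edge (e : edge G) : #|val e| = 2.
Proof. by case: e => e /=; rewrite complete_edgesE inE => /eqP. Qed.

Lemma card_complete_edges : #|{: edge G}| = 'C(#|G|, 2).
Proof. by rewrite card_sig complete_edgesE -card_draws; apply: eq_card => e; rewrite !inE. Qed.

Lemma complete_edge_exists (x y : G) : x != y -> [set x; y] \in edges G.
Proof. by move=> xy; rewrite complete_edgesE inE cards2 xy. Qed.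

(** Edges with 2, 1 or 0 common ends are equal, adjacent, or joined through a third edge. The sum
    form avoids truncated subtraction. *)
Lemma dist_line_complete (e f : line_graph G) :
  (dist e f + #|val e :&: val f| = 2)%N.
Proof.
have card_e := card_complete_edge e; have card_f := card_complete_edge f.
have [<-|ef] := eqVneq e f.
  by rewrite setIid card_e (@dist_eq _ 0) // has_path0.
have [ef0|ef_meet] := eqVneq (val e :&: val f) set0.
  rewrite ef0 cards0 addn0; apply: dist_eq => [|[|[|j]] // _].
  2: by rewrite has_path0.
  2: by rewrite has_path1 /= /line_adj ef0 eqxx andbF.
  have /set0Pn[x xe]: val e != set0 by rewrite -card_gt0 card_e.
  have /set0Pn[y yf]: val f != set0 by rewrite -card_gt0 card_f.
  have xNf : x \notin val f.
    by apply/negP => xf; have := in_set0 x; rewrite -ef0 inE xe xf.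
  have yNe : y \notin val e.
    by apply/negP => ye; have := in_set0 y; rewrite -ef0 inE ye yf.
  have xy : x != y by apply: contraNneq xNf => ->.
  (* By completeness, an end of [e] and an end of [f] span an edge; it meets both and differs from
     both. *)
  pose g : edge G := exist _ [set x; y] (complete_edge_exists x y xy).
  apply: (@has_path2 _ e f g) => //=; rewrite /line_adj.
    apply/andP; split.
      by apply: contraNneq yNe => ->; rewrite /= !inE eqxx orbT.
    by apply/set0Pn; exists x; rewrite /= !inE xe eqxx.
  apply/andP; split.
    by apply: contraNneq xNf => <-; rewrite /= !inE eqxx.
  by apply/set0Pn; exists y; rewrite /= !inE yf eqxx orbT.
rewrite (@dist_eq _ 1) => [||[|] // _].
(* Two common ends would make the intersection equal to both edges, hence [e = f]. *)
- congr (1 + _)%N; apply/eqP; rewrite eqn_leq card_gt0 ef_meet andbT leqNgt.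
  apply: contra ef => meet2; apply/eqP/val_inj.
  have <- : val e :&: val f = val e.
    by apply/eqP; rewrite eqEcard subsetIl card_e.
  by apply/eqP; rewrite eqEcard subsetIr card_f.
- by rewrite has_path1 /= /line_adj ef ef_meet.
- by rewrite has_path0.
Qed.

(** The map sending [y] to [[set x; y]] is a bijection from the vertices other than [x] to the edges
    at [x]. *)
Lemma complete_degree (x : G) : #|[set e : edge G | x \in val e]| = #|G|.-1.
Proof.
rewrite -(card_imset _ val_inj) -(cardC1 x).
have inj : {in [set~ x] &, injective (fun y => [set x; y])}.
  move=> y z; rewrite !inE => yx zx /setP/(_ y).
  by rewrite !inE eqxx orbT (negPf yx) => /esym/eqP.
have <- : #|[set~ x]| = #|predC1 x| by apply: eq_card => y; rewrite !inE.
rewrite -(card_in_imset inj); apply: eq_card => e.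
apply/imsetP/imsetP => [[f + ->]|[y + ->]].
  rewrite inE => xf; have := card_complete_edge f.
  rewrite (cardsD1 x) xf => -[/eqP/cards1P[y fy]].
  exists y; last by rewrite -fy setD1K.
  by have := set11 y; rewrite -fy !inE => /andP[].
rewrite !inE eq_sym => xy.
by exists (exist _ [set x; y] (complete_edge_exists x y xy)); rewrite // !inE eqxx.
Qed.

Lemma sum_card_meet_complete :
  (\sum_(e : edge G) \sum_(f : edge G) #|val e :&: val f| = #|G| * #|G|.-1 ^ 2)%N.
Proof.
(* Each intersection size becomes a sum of indicators over [x]; with the sum over [x] outermost,
   each [x] contributes the square of its degree. *)
under eq_bigr => e _ do under eq_bigr => f _ do
  rewrite -sum1_card big_mkcond /=.
under eq_bigr => e _ do rewrite exchange_big /=.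
rewrite exchange_big /= -sum_nat_const; apply: eq_bigr => x _.
rewrite -mulnn -{1}(complete_degree x).
transitivity (\sum_(e : edge G) (x \in val e) * #|G|.-1)%N.
  apply: eq_bigr => e _; rewrite -(complete_degree x) -sum1_card.
  rewrite [in RHS]big_mkcond big_distrr /=.
  by apply: eq_bigr => f _; rewrite !inE; do 2!case: (x \in _).
rewrite -big_distrl /=; congr (_ * _)%N; rewrite -sum1_card [in RHS]big_mkcond /=.
by apply: eq_bigr => e _; rewrite inE; case: (x \in _).
Qed.

Lemma wiener_index_line_complete :
  wiener_index (line_graph G) =
    1 / 4%:R * #|G|%:R * (#|G|%:R - 1) ^+ 2 * (#|G|%:R - 2%:R).
Proof.
(* Distance plus number of common ends is 2 for every ordered pair of edges, so the grand total is
   twice the number of pairs. *)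
have total : (\sum_(e : line_graph G) \sum_(f : line_graph G) dist e f
              + #|G| * #|G|.-1 ^ 2 = 'C(#|G|, 2) * ('C(#|G|, 2) * 2))%N.
  rewrite -sum_card_meet_complete -big_split /= -card_complete_edges -!sum_nat_const.
  apply: eq_bigr => e _; rewrite -big_split /=.
  by apply: eq_bigr => f _; rewrite dist_line_complete.
rewrite /wiener_index.
under eq_bigr => e _ do rewrite -natr_sum.
rewrite -natr_sum; move: total; set S := (\sum_e _)%N.
(* The empty graph is treated apart, since [#|G|.-1] equals [#|G| - 1] in the rationals only for
   nonempty [G]. *)
case: #|G| => [|m] /=; first by rewrite addn0 => ->; rewrite !mulr0 !mul0r.
move=> /(congr1 (fun n => n%:R : rat)).
have /(congr1 (fun n => n%:R : rat)) : ('C(m.+1, 2) * 2 = m.+1 * m)%N.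
  by rewrite mulnC -mul_bin_diag bin1.
rewrite natrD !natrM => binE total.
have -> : S%:R = 'C(m.+1, 2)%:R * ('C(m.+1, 2)%:R * 2) - m.+1%:R * (m%:R * m%:R) :> rat.
  by rewrite -total addrK.
have -> : 'C(m.+1, 2)%:R = m.+1%:R * m%:R / 2 :> rat by rewrite -binE mulfK.
rewrite -(natr1 m).
by field.
Qed.

End CompleteGraph.

Section ZeroDivisors.

Variable p : nat.
Hypothesis p_prime : prime p.

Lemma square_prime_gt1 : (1 < p ^ 2)%N.
Proof. by rewrite -(exp1n 2) ltn_exp2r // prime_gt1. Qed.

(** An element is represented by a natural number below [n], and only 0 is then a multiple of [n].
    The bound [1 < n] ensures that ['Z_n] really has modulus [n]. *)
Lemma Zp_eq0 (n : nat) (x : 'Z_n) : (1 < n)%N -> (x == 0) = (n %| x)%N.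
Proof.
move=> n_gt1; apply/eqP/idP => [->|]; first by rewrite dvdn0.
have : (x < n)%N by rewrite -[X in (_ < X)%N](Zp_cast n_gt1).
move=> xn nx; apply/val_inj/eqP => /=; apply: contraTT nx.
by rewrite -lt0n => x0; rewrite gtnNdvd.
Qed.

Lemma Zp_mul_eq0 (n : nat) (x y : 'Z_n) :
  (1 < n)%N -> (x * y == 0) = (n %| x * y)%N.
Proof.
by move=> n_gt1; rewrite Zp_eq0 //= [X in (_ %% X)%N]Zp_cast // /dvdn modn_mod.
Qed.

Lemma nonzero_zero_divisorE (x : 'Z_(p ^ 2)) :
  nonzero_zero_divisor x = (x != 0) && (p %| x)%N.
Proof.
have n_gt1 := square_prime_gt1.
rewrite /nonzero_zero_divisor; case: (x != 0) => //=.
apply/existsP/idP => [[y /andP[y0]]|px].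
  (* If [p] does not divide [x], then [x] is coprime to [p ^ 2], and [x * y = 0] forces [y = 0]. *)
  apply: contraTT => pNx; rewrite Zp_mul_eq0 // Gauss_dvdr -?Zp_eq0 //.
  by rewrite coprimeXl // prime_coprime.
have p_val : (p%:R : 'Z_(p ^ 2)) = p :> nat.
  by rewrite val_Zp_nat // modn_small // ltn_Pmull ?prime_gt1 ?prime_gt0.
(* The class of [p] annihilates every multiple of [p], and is nonzero because [0 < p < p ^ 2]. *)
exists p%:R; rewrite Zp_mul_eq0 // Zp_eq0 // p_val; apply/andP; split.
  by rewrite gtnNdvd ?prime_gt0 // ltn_Pmull ?prime_gt1 ?prime_gt0.
exact: dvdn_mul.
Qed.

Lemma zero_divisor_graph_complete (x y : zero_divisor_graph 'Z_(p ^ 2)) :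
  adj x y = (x != y).
Proof.
rewrite /= /zd_adj; case: (x != y) => //=.
rewrite Zp_mul_eq0 ?square_prime_gt1 //.
have := valP x; have := valP y; rewrite !nonzero_zero_divisorE.
by move=> /andP[_ py] /andP[_ px]; apply: dvdn_mul.
Qed.

Lemma card_zero_divisor_graph : #|zero_divisor_graph 'Z_(p ^ 2)| = p.-1.
Proof.
have n_gt1 := square_prime_gt1; have p_gt0 := prime_gt0 p_prime.
(* The shift to [i.+1] leaves out 0, and [i.+1 < p] keeps the product below [p ^ 2], so no reduction
   occurs. *)
pose f (i : 'I_p.-1) : 'Z_(p ^ 2) := (i.+1 * p)%:R.
have fE i : f i = (i.+1 * p)%N :> nat.
  rewrite val_Zp_nat // modn_small // ltn_mul2r p_gt0 /=.
  by rewrite -[p in (_ < p)%N]prednK // ltnS.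
have inj : injective f.
  move=> i j /(congr1 (@nat_of_ord _)); rewrite !fE => /eqP.
  by rewrite eqn_pmul2r // eqSS => /eqP/val_inj.
rewrite card_sig -[RHS]card_ord -(card_codom inj); apply: eq_card => x.
rewrite inE nonzero_zero_divisorE; apply/andP/codomP => [[x0 /dvdnP[k xk]]|[i ->]].
  have k_gt0 : (0 < k)%N.
    by rewrite lt0n; apply: contraNneq x0 => k0; apply/eqP/val_inj; rewrite /= xk k0.
  have kp : (k.-1 < p.-1)%N.
    have : (x < p ^ 2)%N by rewrite -[X in (_ < X)%N](Zp_cast n_gt1).
    by rewrite xk -mulnn ltn_mul2r p_gt0 ltn_predRL prednK.
  by exists (Ordinal kp); apply: val_inj; rewrite [RHS]fE /= prednK.
by rewrite fE dvdn_mull // -val_eqE [val _]fE /= muln_eq0 -[p == 0]negbK -lt0n p_gt0.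
Qed.

End ZeroDivisors.

Theorem theorem3p8 (p : nat) (p_prime : prime p) (p_ge5 : (5 <= p)%N) :
  wiener_index (line_graph (zero_divisor_graph 'Z_(p ^ 2)%N)) =
    1 / 4%:R * (p%:R - 1) * (p%:R - 2%:R) ^+ 2 * (p%:R - 3%:R) :> rat.
Proof.
rewrite wiener_index_line_complete; last exact: zero_divisor_graph_complete.
(* With [p - 1] vertices, the factors [#|G| - 1] and [#|G| - 2] become [p - 2] and [p - 3]. *)
rewrite card_zero_divisor_graph // -subn1 natrB ?prime_gt0 //.
by ring.
Qed.
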